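(* For every fixed $\varepsilon\in(0,0.9]$ and $a\in(0,1)$, for every graph $G=(V,E)$ with minimum degree $\delta\ge \left\lceil 626\,a^{-1}\varepsilon^{-2}\ln\left((a\varepsilon)^{-1}\right)\right\rceil$, for every $\varepsilon$-excessive list assignment $L:E\to 2^C$ of $G$ associated with any tolerance function $\alpha:C\to(0,1)$ with $\min(\alpha)\geq a$, there is an $\alpha$-majority $L$-colouring of $G$.
   Context: A graph means a finite simple graph; $d(v)$ is the degree of $v$ in $G$. Let $C$ be a set of colours. A list assignment is a function $L:E\to 2^C$; a tolerance function of $L$ is any function $\alpha:C\to(0,1)$, and $\min(\alpha):=\min_{c'\in C}\alpha(c')$. The list assignment $L$ (with tolerance function $\alpha$) is called $\varepsilon$-excessive, for $\varepsilon>0$, if $\sum_{c\in L(e)}\alpha(c)\geq 1+\varepsilon$ for every edge $e\in E$. An $\alpha$-majority $L$-colouring of $G$ is a (not necessarily proper) edge colouring $\omega:E\to C$ such that $\omega(e)\in L(e)$ for every $e\in E$ and, for every vertex $v\in V$ and every colour $c\in C$, the number of edges incident with $v$ that are coloured $c$ by $\omega$ is at most $\alpha(c)d(v)$. *)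

(* Defs.v *)
From HB Require Import structures.
From mathcomp Require Import all_boot all_order all_algebra.
From mathcomp Require Import all_classical all_reals all_analysis.

Set Implicit Arguments.
Unset Strict Implicit.
Unset Printing Implicit Defensive.

Import Order.TTheory GRing.Theory Num.Theory.

Local Open Scope ring_scope.

Record sgraph := SGraph {
  vertex :> finType;
  adj : rel vertex;
  adj_sym : symmetric adj;
  adj_irrefl : irreflexive adj
}.

Definition is_edge (G : sgraph) (A : {set G}) : bool :=
  [exists u, exists v, adj u v && (A == [set u; v])].

(* E is a type of its own, so that list assignments and colourings are defined
   on the edges only; in particular an edgeless graph has a colouring even when
   there are no colours. *)
Notation edge G := {A : {set vertex G} | is_edge A}.

Definition deg (G : sgraph) (v : G) : nat := #|[set e : edge G | v \in val e]|.

(* The default value #|E| bounds every degree, so this is the minimum of the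
   degrees as soon as G has a vertex; it is 0 if G has none. *)
Definition min_deg (G : sgraph) : nat := \big[minn/#|{: edge G}|]_(v : G) deg v.

Definition tolerance (R : realType) (C : choiceType) (alpha : C -> R) : Prop :=
  forall c, 0 < alpha c < 1.

(* C may be infinite, hence an infimum; it is the minimum whenever that is
   attained, in particular when C is finite and nonempty. *)
Definition min_tol (R : realType) (C : choiceType) (alpha : C -> R) : R :=
  inf (range alpha).

(* Lists may be infinite as well, hence a sum in the extended reals. *)
Definition excessive (R : realType) (C : choiceType) (G : sgraph) (eps : R)
    (alpha : C -> R) (L : edge G -> set C) : Prop :=
  forall e, ((1 + eps)%:E <= \esum_(c in L e) (alpha c)%:E)%E.

Definition majority_colouring (R : realType) (C : choiceType) (G : sgraph)
    (alpha : C -> R) (L : edge G -> set C) (omega : edge G -> C) : Prop :=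
  (forall e, L e (omega e)) /\
  (forall (v : G) (c : C),
     #|[set e : edge G | (v \in val e) && (omega e == c)]|%:R
       <= alpha c * (deg v)%:R).

(* Main.v *)
Require Import Defs.
From HB Require Import structures.
From mathcomp Require Import all_boot all_order all_algebra.
From mathcomp Require Import all_classical all_reals all_analysis.
From mathcomp Require Import ring lra zify.

Set Implicit Arguments.
Unset Strict Implicit.
Unset Printing Implicit Defensive.

Import Order.TTheory GRing.Theory Num.Theory.

Local Open Scope ring_scope.

(** The proof replaces random colouring by rounding a fractional colouring, in
    the style of Beck and Fiala.

    Excess leaves room in each list for a finite sublist of total tolerance
    m(e) > 1 + eps/2. Give edge e the colour c of this sublist with weight
    alpha(c) / m(e). The weights at e sum to 1, and the colour c has total
    weight at most alpha(c) d(v) / (1 + eps/2) at a vertex v. It remains to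
    choose one colour of positive weight on each edge so that no colour exceeds
    its weight at a vertex by more than an absolute constant: the gap
    alpha(c) d(v) (1 - 1 / (1 + eps/2)) is at least 4 under the assumed bound on
    the minimum degree (rounding_slack).

    The rounding (choice_with_small_overload) is a general statement: if
    weights on a finite set I sum to 1 on each fibre of p : I -> E, and every
    element of I lies in at most t sets of a family S, then one can choose one
    element of positive weight in each fibre so that each set S j receives at
    most its weight plus 2t choices. Here I consists of the pairs (edge, colour)
    and the family is indexed by the pairs (vertex, colour). As an edge has two
    ends, t = 2 and the overload is at most 4.

    To round, look at the set F of the weights strictly between 0 and 1. Keep
    the equation of each fibre that meets F, and that of each set with more than
    2t elements in F. There are fewer equations than elements of F
    (card_tight_constraints), so the weights can be moved along a nonzero
    solution of the homogeneous system until one of them vanishes. A set with at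
    most 2t elements in F can be ignored for ever, since its support is already
    within 2t of its weight, and supports only shrink. *)

(** * Linear systems and nonnegative vectors *)

Lemma exists_nonzero_solution (K : fieldType) (I J : finType) (M : I -> J -> K)
    (F : {set I}) (D : {set J}) :
  (#|D| < #|F|)%N ->
  exists y : I -> K, [/\ exists i, y i != 0, forall i, i \notin F -> y i = 0 &
    forall j, j \in D -> \sum_i y i * M i j = 0].
Proof.
move=> ltDF.
pose A := \matrix_(i < #|F|, j < #|D|) M (enum_val i) (enum_val j).
have : kermx A != 0.
  rewrite kermx_eq0 /row_free; apply: contraL ltDF => /eqP rkA.
  by rewrite -leqNgt -rkA rank_leq_col.
case/rowV0Pn=> v /sub_kermxP vA0 v0.
(* v transported to I along the enumeration of F, with value 0 outside F *)
pose y i := \sum_(k < #|F| | enum_val k == i) v 0 k.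
have y_val k : y (enum_val k) = v 0 k.
  rewrite /y (big_pred1 k) // => k'; exact: (inj_eq enum_val_inj).
exists y; split.
- apply: contrapT => /forallNP y0; case/negP: v0; apply/eqP/rowP => k.
  by rewrite mxE -y_val; apply/eqP/negPn/negP/y0.
- move=> i iF; apply: big1 => k /eqP ki; move: iF.
  by rewrite -ki enum_valP.
- move=> j jD; transitivity ((v *m A) 0 (enum_rank_in jD j)); last first.
    by rewrite vA0 mxE.
  rewrite mxE; under [RHS]eq_bigr do rewrite mxE enum_rankK_in //.
  rewrite /y; under [LHS]eq_bigr do rewrite mulr_suml.
  rewrite (exchange_big_dep xpredT) //=; apply: eq_bigr => k _.
  by rewrite (big_pred1 (enum_val k)) // => i; rewrite eq_sym.
Qed.

(** Starting from x, move along the line of direction y until it first leaves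
    the nonnegative orthant, in whichever of the two directions that happens
    sooner; the coordinate with the least ratio x i / |y i| is the one that
    vanishes. *)
Lemma shift_to_boundary (R : realFieldType) (I : finType) (x y : I -> R) :
  (forall i, 0 <= x i) -> (exists i, y i != 0) ->
  exists t, (forall i, 0 <= x i + t * y i) /\
    exists2 i, y i != 0 & x i + t * y i = 0.
Proof.
move=> x0 [i1 yi1].
case: (@Order.TotalTheory.arg_minP _ _ _ i1 (fun i => y i != 0)
  (fun i => x i / `|y i|) yi1) => i0 yi0 min0.
exists (- (x i0 / y i0)); split; last first.
  by exists i0 => //; rewrite mulNr divfK // subrr.
move=> i; have [->|yi] := eqVneq (y i) 0; first by rewrite mulr0 addr0.
rewrite mulNr subr_ge0; apply: le_trans (ler_norm _) _.
rewrite normrM normf_div (ger0_norm (x0 i0)) -ler_pdivlMr ?normr_gt0 //.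
exact: min0.
Qed.

(** * Rounding with bounded overload *)

Definition supp (R : realFieldType) (I : finType) (x : I -> R) : {set I} :=
  [set i | 0 < x i].

Section Rounding.
Variables (R : realFieldType) (I E J : finType) (p : I -> E) (S : J -> {set I}).
Variables (t : nat) (b : J -> R).
Hypothesis St : forall i, (#|[set j | i \in S j]| <= t)%N.

Definition fractional (x : I -> R) : {set I} := [set i | 0 < x i < 1].

(** The invariant of the rounding. The second alternative is about the support,
    not the weight, so that it persists when the support shrinks, however the
    weights in S j change. *)
Definition admissible (x : I -> R) : Prop :=
  [/\ forall i, 0 <= x i,
      forall e, \sum_(i | p i == e) x i = 1 &
      forall j, \sum_(i in S j) x i <= b j \/
                #|supp x :&: S j|%:R <= b j + (2 * t)%:R].

(** Double counting. A fibre that meets the fractional set F meets it at least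
    twice, so there are at most |F| / 2 such fibres. There are at most t |F|
    incidences between F and the sets, so at most t |F| / (2t + 1) < |F| / 2
    sets have more than 2t elements in F. *)
Lemma card_tight_constraints (x : I -> R) :
  (forall e, \sum_(i | p i == e) x i = 1) -> (forall i, 0 <= x i) ->
  (0 < #|fractional x|)%N ->
  (#|p @: fractional x| + #|[set j | 2 * t < #|fractional x :&: S j|]|
     < #|fractional x|)%N.
Proof.
move=> x1 x0; set F := fractional x; set D := [set j | _] => Fgt0.
have cE : (2 * #|p @: F| <= #|F|)%N.
  rewrite -[X in (_ <= X)%N]sum1_card.
  rewrite (partition_big_imset p) /= mulnC -sum_nat_const.
  apply: leq_sum => _ /imsetP[i iF ->].
  (* a single value below 1 cannot sum to 1 over its fibre *)
  have [k kF [ki pk]] : exists2 k, k \in F & k != i /\ p k = p i.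
    move: iF; rewrite inE => /andP[xi0 xi1].
    have sumD1 := x1 (p i); rewrite (bigD1 i) //= in sumD1.
    have [k /andP[pk ki] xk] :
        exists2 k, (p k == p i) && (k != i) & 0 < x k.
      apply: contrapT => nk; move: xi1.
      rewrite -sumD1 big1 ?addr0 ?ltxx // => k Pk.
      apply/eqP; rewrite eq_le x0 andbT leNgt.
      by apply/negP => xk; apply: nk; exists k.
    exists k; last by split=> //; apply/eqP.
    rewrite inE xk -sumD1 (bigD1 k) ?pk //=.
    rewrite ltr_pwDl // lerDl; exact: sumr_ge0.
  rewrite (bigD1 i) ?iF ?eqxx //= (bigD1 k) ?kF ?pk ?eqxx ?ki //=.
have cD : ((2 * t).+1 * #|D| <= t * #|F|)%N.
  rewrite mulnC -sum_nat_const.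
  apply: (@leq_trans (\sum_j #|F :&: S j|)%N).
    rewrite [X in (_ <= X)%N](bigID (mem D)) /=.
    apply: leq_trans (leq_addr _ _).
    by apply: leq_sum => j; rewrite inE.
  under eq_bigr do rewrite -sum1_card big_mkcond /=.
  rewrite exchange_big /= mulnC -sum_nat_const [X in (_ <= X)%N]big_mkcond.
  apply: leq_sum => i _; case: ifP => iF; last first.
    by rewrite big1 // => j _; rewrite finset.in_setI iF.
  apply: leq_trans (St i); rewrite -sum1_card [X in (_ <= X)%N]big_mkcond /=.
  by apply: leq_sum => j _; rewrite finset.in_setI iF inE.
nia.
Qed.

Lemma admissible_le1 (x : I -> R) i : admissible x -> x i <= 1.
Proof.
by case=> x0 x1 _; rewrite -(x1 (p i)) (bigD1 i) //= lerDl; apply: sumr_ge0.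
Qed.

(** An element of the support either has weight 1 or is fractional. So a set
    with few fractional elements has a support not much larger than its weight,
    which is what allows its constraint to be dropped. *)
Lemma card_supp_le (x : I -> R) (A : {set I}) : admissible x ->
  #|supp x :&: A|%:R <= \sum_(i in A) x i + #|fractional x :&: A|%:R.
Proof.
move=> adx; have [x0 _ _] := adx.
have cardE (B : {set I}) : #|B :&: A|%:R = \sum_(i in A) (i \in B)%:R :> R.
  rewrite -sum1_card natr_sum (eq_bigl (fun i => (i \in A) && (i \in B))).
    by rewrite big_mkcondr /=; apply: eq_bigr => i _; case: (i \in B).
  by move=> i; rewrite finset.in_setI andbC.
rewrite !cardE -big_split /=; apply: ler_sum => i _; rewrite !inE.
have := x0 i; have := admissible_le1 i adx.
case: (ltgtP (x i) 0) => //= [_|->]; last by rewrite addr0.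
by case: ltgtP => //= [_ _ |-> _ _]; rewrite ?addr0 ?lerDr.
Qed.

(** The direction of the move is supported in the fractional set and solves the
    equations of the fibres that meet it and of the sets with more than 2t
    fractional elements. The move preserves all these sums, and kills one
    element of the support. *)
Lemma admissible_step (x : I -> R) : admissible x -> (0 < #|fractional x|)%N ->
  exists2 x', admissible x' & supp x' \proper supp x.
Proof.
move=> adx Fgt0; have [x0 x1 xS] := adx.
set F := fractional x.
have ltDF := card_tight_constraints x1 x0 Fgt0.
set D := [set j | _] in ltDF.
pose T : {set E + J} := (inl @: (p @: F)) :|: (inr @: D).
pose M i (k : E + J) : R :=
  match k with inl e => (p i == e)%:R | inr j => (i \in S j)%:R end.
have ltTF : (#|T| < #|F|)%N.
  apply: leq_ltn_trans ltDF; rewrite cardsU.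
  by apply: leq_trans (leq_subr _ _) _; apply: leq_add; apply: leq_imset_card.
have [y [y_neq0 yF yT]] := exists_nonzero_solution M ltTF.
have sumM (P : pred I) : \sum_i y i * (P i)%:R = \sum_(i | P i) y i.
  rewrite [RHS]big_mkcond; apply: eq_bigr => i _.
  by case: (P i); rewrite ?mulr1 ?mulr0.
have yE e : \sum_(i | p i == e) y i = 0.
  have [eF|eF] := boolP (e \in p @: F).
    rewrite -sumM; apply: (yT (inl e)).
    by rewrite finset.in_setU imset_f.
  apply: big1 => i /eqP pi; apply: yF; apply: contra eF => iF.
  by rewrite -pi imset_f.
have yS j : j \in D -> \sum_(i in S j) y i = 0.
  move=> jD; rewrite -sumM; apply: (yT (inr j)).
  by rewrite finset.in_setU imset_f ?orbT.
have [s [x'0 [i0 yi0 x'i0]]] := shift_to_boundary x0 y_neq0.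
pose x' i := x i + s * y i.
have sumx' (P : pred I) : \sum_(i | P i) y i = 0 ->
    \sum_(i | P i) x' i = \sum_(i | P i) x i.
  by move=> yP; rewrite big_split /= -mulr_sumr yP mulr0 addr0.
have supp_sub : supp x' \subset supp x.
  apply/fintype.subsetP => i; rewrite !inE /x'.
  have [|/yF ->] := boolP (i \in F); last by rewrite mulr0 addr0.
  by rewrite inE => /andP[].
exists x'; first split=> // [e|j].
- by rewrite sumx'.
- have card_sub : #|supp x' :&: S j|%:R <= #|supp x :&: S j|%:R :> R.
    by rewrite ler_nat subset_leq_card // finset.setSI.
  case: (xS j) => [xj|xj]; last by right; apply: le_trans card_sub xj.
  have [jD|jD] := boolP (j \in D); first by left; rewrite sumx' ?yS.
  (* at most 2t fractional elements: pass from the weight to the support *)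
  right; apply: le_trans card_sub _; apply: le_trans (card_supp_le _ adx) _.
  by apply: lerD; rewrite // ler_nat leqNgt; move: jD; rewrite inE.
- rewrite properE supp_sub /=; apply/subsetPn; exists i0.
    have : i0 \in F by apply: contraR yi0 => /yF ->.
    by rewrite !inE => /andP[].
  by rewrite inE /x' x'i0 ltxx.
Qed.

Lemma admissible_integral (x : I -> R) : admissible x ->
  exists x', [/\ admissible x', supp x' \subset supp x &
    forall i, x' i = 0 \/ x' i = 1].
Proof.
have [n] := ubnP #|supp x|; elim: n x => // n IH x ltn adx.
have [F0|Fgt0] := posnP #|fractional x|.
  exists x; split=> // i.
  have : i \notin fractional x by rewrite (finset.cards0_eq F0) finset.in_set0.
  case: adx (admissible_le1 i adx) => x0 _ _ xi1; rewrite inE.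
  have := x0 i; case: ltgtP => //= [_|->]; last by left.
  by case: ltgtP xi1 => // ->; right.
have [x1 adx1 prop1] := admissible_step adx Fgt0.
have [|x2 [adx2 sub2 int2]] := IH x1 _ adx1.
  exact: leq_trans (proper_card prop1) _.
by exists x2; split=> //; apply: fintype.subset_trans sub2 (proper_sub prop1).
Qed.

End Rounding.

(** For an integral weight, the weight of a set is the size of its support, so
    both alternatives of the invariant bound the number of choices. *)
Theorem choice_with_small_overload (R : realFieldType) (I E J : finType)
    (p : I -> E) (S : J -> {set I}) (t : nat) (x : I -> R) :
  (forall i, (#|[set j | i \in S j]| <= t)%N) ->
  (forall i, 0 <= x i) -> (forall e, \sum_(i | p i == e) x i = 1) ->
  exists f : E -> I, [/\ cancel f p, forall e, 0 < x (f e) &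
    forall j, #|[set e | f e \in S j]|%:R
                <= \sum_(i in S j) x i + (2 * t)%:R].
Proof.
move=> St x0 x1.
have adx : admissible p S t (fun j => \sum_(i in S j) x i) x.
  by split=> // j; left.
have [z [[z0 z1 zS] sub_zx zint]] := admissible_integral St adx.
have /choice[f fP] : forall e, exists i, p i = e /\ z i = 1.
  move=> e; apply: contrapT => ne; move: (z1 e).
  rewrite big1 => [/eqP|i /eqP pi]; first by rewrite eq_sym oner_eq0.
  by case: (zint i) => // zi; case: ne; exists i.
have fK : cancel f p by move=> e; case: (fP e).
have fz e : f e \in supp z by rewrite inE; case: (fP e) => _ ->; rewrite ltr01.
exists f; split=> // [e|j].
  by have := fintype.subsetP sub_zx _ (fz e); rewrite inE.
have cardf : (#|[set e | f e \in S j]| <= #|supp z :&: S j|)%N.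
  rewrite -(card_imset _ (can_inj fK)); apply: subset_leq_card.
  apply/fintype.subsetP => _ /imsetP[e eS ->].
  by rewrite finset.in_setI fz; move: eS; rewrite inE.
apply: le_trans (_ : #|supp z :&: S j|%:R <= _); first by rewrite ler_nat.
case: (zS j) => // le_zb; apply: (@le_trans _ _ (\sum_(i in S j) z i)).
  rewrite -sum1_card natr_sum (eq_bigl (fun i => (i \in S j) && (0 < z i))).
    rewrite big_mkcondr /=; apply: ler_sum => i _; case: (zint i) => ->.
      by rewrite ltxx.
    by rewrite ltr01.
  by move=> i; rewrite finset.in_setI inE andbC.
by apply: le_trans le_zb _; rewrite lerDl ler0n.
Qed.

(** * From list assignments to fractional colourings *)

(** Strictness matters: the supremum of the finite sums need not be attained.
    This is why half of the excess is given up later. *)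
Lemma finite_partial_sum (R : realType) (C : choiceType) (alpha : C -> R)
    (A : set C) (s : R) :
  (s%:E < \esum_(c in A) (alpha c)%:E)%E ->
  exists r : seq C,
    [/\ uniq r, forall c, c \in r -> A c & s < \sum_(c <- r) alpha c].
Proof.
rewrite /esum => /ereal_sup_gt[_ [B [finB BA] <-]].
rewrite fsbig_finite //= sumEFin lte_fin => ltsB.
exists (finmap.enum_fset (fset_set B)); split=> // c.
by rewrite in_fset_set // => /set_mem/BA.
Qed.

Lemma edge_ends_le2 (G : sgraph) (e : edge G) : (#|val e| <= 2)%N.
Proof.
case: e => A /= /existsP[u /existsP[v /andP[_ /eqP ->]]].
by rewrite cards2; case: (_ != _).
Qed.

(** The pair (e, k) lies in the set of (v, k') exactly when v is an end of e and
    k = k', hence in at most two of these sets. *)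
Lemma round_fractional_colouring (R : realFieldType) (G : sgraph) (K : finType)
    (w : edge G -> K -> R) :
  (forall e k, 0 <= w e k) -> (forall e, \sum_k w e k = 1) ->
  exists f : edge G -> K, (forall e, 0 < w e (f e)) /\
    forall v k, #|[set e : edge G | (v \in val e) && (f e == k)]|%:R
                  <= \sum_(e : edge G | v \in val e) w e k + 4.
Proof.
move=> w0 w1.
pose S (j : G * K) : {set edge G * K} :=
  [set i : edge G * K | (j.1 \in val i.1) && (i.2 == j.2)].
have S2 i : (#|[set j | i \in S j]| <= 2)%N.
  apply: leq_trans (edge_ends_le2 i.1).
  apply: leq_trans (leq_imset_card (fun v => (v, i.2)) (val i.1)).
  apply/subset_leq_card/fintype.subsetP => -[v k]; rewrite !inE /=.
  by case/andP=> vi /eqP <-; apply: imset_f.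
have sumw e : \sum_(i : edge G * K | i.1 == e) w i.1 i.2 = 1.
  rewrite -(w1 e) -[RHS](big_pred1_eq +%R e (fun e' => \sum_k w e' k)).
  by rewrite pair_big /=; apply: eq_bigl => i; rewrite andbT.
have [f [fK f0 fS]] := choice_with_small_overload S2 (fun i => w0 i.1 i.2) sumw.
exists (fun e => (f e).2); split=> [e|v k].
  by have := f0 e; rewrite fK.
have := fS (v, k); congr (_ <= _).
  by congr _%:R; apply: eq_card => e; rewrite !inE /= fK.
congr (_ + _); under [RHS]eq_bigr do rewrite -(big_pred1_eq +%R k).
by rewrite pair_big /=; apply: eq_bigl => i; rewrite inE.
Qed.

Lemma sum_seq_sub (R : nmodType) (C : choiceType) (T r : seq C) (F : C -> R) :
  uniq r -> {subset r <= T} ->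
  \sum_(k : seq_sub T | val k \in r) F (val k) = \sum_(c <- r) F c.
Proof.
move=> uniq_r rT; rewrite -(big_map val (mem r) F) -big_filter.
apply: perm_big; apply: uniq_perm => //.
  by rewrite filter_uniq // map_inj_uniq ?index_enum_uniq //; apply: val_inj.
move=> c; rewrite mem_filter /= andb_idr // => cr.
by apply/mapP; exists (SeqSub (rT c cr)); rewrite ?mem_index_enum.
Qed.

Lemma tolerance_ge_min (R : realType) (C : choiceType) (alpha : C -> R) c :
  tolerance alpha -> min_tol alpha <= alpha c.
Proof.
move=> alpha01; apply: ge_inf; last by exists c.
by exists 0 => _ [c' _ <-]; case/andP: (alpha01 c') => /ltW.
Qed.

Lemma min_deg_le (G : sgraph) (v : G) : (min_deg G <= deg v)%N.
Proof. by rewrite /min_deg -minEnat -leEnat; apply: bigmin_le. Qed.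

(** From ln x <= x - 1 and a eps <= 9/10 the logarithm is at least 1/10, so
    al d >= 62.6 / eps^2, whereas al d >= 4 (2 + eps) / eps would suffice: the
    logarithmic factor is used only as a constant. *)
Lemma rounding_slack (R : realType) (eps a al d : R) :
  0 < eps <= 9 / 10 -> 0 < a < 1 -> a <= al ->
  626 * a^-1 * eps ^- 2 * ln ((a * eps)^-1) <= d ->
  al * d / (1 + eps / 2) + 4 <= al * d.
Proof.
move=> /andP[eps0 eps9] /andP[a0 a1] le_a_al led.
have ae0 : 0 < a * eps by rewrite mulr_gt0.
have ln_ge : 1 / 10 <= ln ((a * eps)^-1).
  rewrite lnV ?posrE //.
  have := @le_ln1Dx R (a * eps - 1); rewrite [1 + _]addrC subrK => ln_le.
  have {}ln_le : ln (a * eps) <= a * eps - 1 by apply: ln_le; lra.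
  nra.
have d0 : 0 <= d.
  apply: le_trans led; rewrite !mulr_ge0 ?invr_ge0 ?exprn_ge0 ?ler0n ?ltW //.
  lra.
have load : 62 <= al * d * eps ^+ 2.
  have : 626 * ln ((a * eps)^-1) <= a * d * eps ^+ 2.
    rewrite -ler_pdivrMr ?exprn_gt0 // -ler_pdivrMl //.
    by apply: le_trans led; rewrite le_eqVlt; apply/orP; left; apply/eqP; ring.
  have : a * d * eps ^+ 2 <= al * d * eps ^+ 2.
    by rewrite !ler_wpM2r ?exprn_ge0 // ltW.
  lra.
rewrite -lerBrDr ler_pdivrMr; last by lra.
have : 62 <= al * d * eps.
  apply: le_trans load _; rewrite expr2 mulrA ler_piMr //; last by lra.
  by rewrite !mulr_ge0 // ?ltW //; lra.
nra.
Qed.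

Theorem theorem15 (R : realType) (eps a : R)
    (heps : 0 < eps <= 9 / 10) (ha : 0 < a < 1)
    (G : sgraph)
    (hdelta : Num.ceil (626 * a^-1 * eps ^- 2 * ln ((a * eps)^-1))
                <= (min_deg G)%:Z)
    (C : choiceType) (alpha : C -> R) (L : edge G -> set C)
    (halpha : tolerance alpha) (hmin : a <= min_tol alpha)
    (hL : excessive eps alpha L) :
  exists omega : edge G -> C, majority_colouring alpha L omega.
Proof.
have /andP[eps0 eps9] := heps.
have alpha0 c : 0 < alpha c by case/andP: (halpha c).
have /choice[r rP] : forall e, exists r : seq C, [/\ uniq r,
    forall c, c \in r -> L e c & 1 + eps / 2 < \sum_(c <- r) alpha c].
  move=> e; apply: finite_partial_sum; apply: lt_le_trans (hL e).
  by rewrite lte_fin; lra.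
(* all colours that matter, so that the rounding takes place in a finite type *)
pose T := flatten [seq r e | e : edge G].
have rT e : {subset r e <= T}.
  by move=> c cr; apply/flatten_mapP; exists e => //; rewrite mem_enum.
pose m e := \sum_(c <- r e) alpha c.
have m_gt e : 1 + eps / 2 < m e by case: (rP e).
have m0 e : 0 < m e by apply: lt_trans (m_gt e); lra.
pose w e (k : seq_sub T) := if val k \in r e then alpha (val k) / m e else 0.
have w0 e k : 0 <= w e k.
  by rewrite /w; case: ifP => // _; rewrite divr_ge0 ?ltW.
have w1 e : \sum_k w e k = 1.
  rewrite -big_mkcond -mulr_suml sum_seq_sub // ?divff ?gt_eqF //.
    exact: m0.
  by case: (rP e).
have [f [f0 fle]] := round_fractional_colouring w0 w1.
exists (fun e => val (f e)); split=> [e|v c].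
  case: (rP e) => _ rL _; apply: rL; move: (f0 e); rewrite /w.
  by case: ifP => //; rewrite ltxx.
have [cT|cT] := boolP (c \in T); last first.
  rewrite eq_card0 ?mulr_ge0 ?ler0n ?ltW // => e; rewrite !inE.
  apply/negbTE; rewrite negb_and orbC (contra _ cT) // => /eqP <-.
  exact: valP.
pose k : seq_sub T := SeqSub cT.
have le_d : 626 * a^-1 * eps ^- 2 * ln ((a * eps)^-1) <= (deg v)%:R.
  rewrite ceil_le_int in hdelta; apply: le_trans hdelta _.
  by rewrite ler_nat min_deg_le.
have le_a : a <= alpha c := le_trans hmin (tolerance_ge_min c halpha).
apply: le_trans (rounding_slack heps ha le_a le_d).
apply: (@le_trans _ _ (\sum_(e : edge G | v \in val e) w e k + 4)).
  apply: le_trans (fle v k); rewrite ler_nat; apply: subset_leq_card.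
  by apply/fintype.subsetP => e; rewrite !inE.
rewrite lerD2r.
have -> : alpha c * (deg v)%:R / (1 + eps / 2)
    = \sum_(e : edge G | v \in val e) alpha c / (1 + eps / 2).
  by rewrite sumr_const /deg cardsE mulrAC mulr_natr.
apply: ler_sum => e _; rewrite /w /=; case: ifP => _; last first.
  by rewrite divr_ge0 ?(ltW (alpha0 c)) //; lra.
rewrite ler_pM2l // lef_pV2 ?posrE ?m0 //; last by lra.
exact: ltW.
Qed.
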